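(* Let $T:\mathbb{R}^k\to\mathbb{R}^k$ be a $\rho$-strongly quasi-nonexpansive operator with $\rho>0$, let $f:\mathbb{R}^k\to\mathbb{R}$ be a convex function with $f(x)\ge 0$ for all $x\in\operatorname{Im}T$, and let $g:\mathbb{R}^k\to\mathbb{R}$ be a concave function for which there exists $M>0$ such that $0<g(x)\le M$ for all $x\in\operatorname{Im}T$. Assume that the problem of minimizing $f(x)/g(x)$ over $x\in\operatorname{Fix}T$ has a nonempty solution set. Let $\{x^n\}_{n=1}^\infty$ be a sequence generated by the AFSSM with stepsizes $\{\eta_n\}_{n=1}^\infty\subset(0,\infty)$. Suppose that $\sum_{n=1}^\infty\eta_n=\infty$ and $\sum_{n=1}^\infty\eta_n^2<\infty$. If the operator $T$ satisfies the demi-closedness principle and the function $f$ is $\sigma$-strongly convex for some $\sigma>0$, then the sequence $\{x^n\}_{n=1}^\infty$ converges to the unique solution of the problem of minimizing $f(x)/g(x)$ over $x\in\operatorname{Fix}T$.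
   Context: $\mathbb{R}^k$ is Euclidean space with inner product $\langle\cdot,\cdot\rangle$ and induced norm $\|\cdot\|$. $\operatorname{Fix}T:=\{x\in\mathbb{R}^k: Tx=x\}$ and $\operatorname{Im}T:=\{Tx: x\in\mathbb{R}^k\}$. An operator $T:\mathbb{R}^k\to\mathbb{R}^k$ with $\operatorname{Fix}T\neq\emptyset$ is $\rho$-strongly quasi-nonexpansive ($\rho\ge 0$) if $\|Tx-z\|^2\le\|x-z\|^2-\rho\|Tx-x\|^2$ for all $x\in\mathbb{R}^k$ and $z\in\operatorname{Fix}T$. $T$ satisfies the demi-closedness principle if for any sequence $\{w^n\}\subset\mathbb{R}^k$ with $w^n\to w\in\mathbb{R}^k$ and $\|Tw^n-w^n\|\to 0$ one has $w\in\operatorname{Fix}T$. $f$ is $\sigma$-strongly convex if $f(\alpha x+(1-\alpha)y)\le\alpha f(x)+(1-\alpha)f(y)-\frac{\sigma}{2}\alpha(1-\alpha)\|x-y\|^2$ for all $x,y\in\mathbb{R}^k$, $\alpha\in[0,1]$. A solution of the problem is a point $x^*\in\operatorname{Fix}T$ with $\frac{f(x^* )}{g(x^* )}=\min_{x\in\operatorname{Fix}T}\frac{f(x)}{g(x)}$. For a convex function $\varphi:\mathbb{R}^k\to\mathbb{R}$, $\partial\varphi(x):=\{u\in\mathbb{R}^k:\langle u,y-x\rangle\le\varphi(y)-\varphi(x)\ \text{for all } y\in\mathbb{R}^k\}$. AFSSM (Adaptive Fixed-Point Subgradient Splitting Method): given stepsizes $\{\eta_n\}_{n=1}^\infty\subset(0,\infty)$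 and an initial point $x^1\in\mathbb{R}^k$ with $g(x^1)>0$, for each $n\in\mathbb{N}=\{1,2,\dots\}$ and current iterate $x^n\in\operatorname{Im}T$ (in particular $x^1\in\operatorname{Im}T$), set $\theta_n=\frac{f(x^n)}{g(x^n)}$, choose arbitrary subgradients $f'(x^n)\in\partial f(x^n)$ and $h'(x^n)\in\partial(-g)(x^n)$, and set $$x^{n+1}=T\left(x^n-\eta_n\frac{f'(x^n)+\theta_n h'(x^n)}{\max\{1,\|f'(x^n)+\theta_n h'(x^n)\|\}}\right).$$ *)

(* Defs.v *)
From HB Require Import structures.
From mathcomp Require Import all_boot all_order all_algebra.
From mathcomp Require Import all_classical all_reals all_analysis.

Set Implicit Arguments.
Unset Strict Implicit.
Unset Printing Implicit Defensive.

Import Order.TTheory GRing.Theory Num.Theory.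
Import numFieldNormedType.Exports.

Local Open Scope classical_set_scope.
Local Open Scope ring_scope.

Definition dot (R : realType) (k : nat) (u v : 'rV[R]_k) : R :=
  \sum_(i < k) u ord0 i * v ord0 i.

(* The library norm `|x| on 'rV[R]_k is the max norm, hence this one. *)
Definition enorm (R : realType) (k : nat) (x : 'rV[R]_k) : R :=
  Num.sqrt (dot x x).

Definition converges_to (R : realType) (k : nat) (w : nat -> 'rV[R]_k)
    (l : 'rV[R]_k) : Prop :=
  enorm (w n - l) @[n --> \oo] --> (0 : R).

Definition Fix (R : realType) (k : nat) (T : 'rV[R]_k -> 'rV[R]_k) :
    set 'rV[R]_k :=
  [set x | T x = x].

Definition strongly_quasi_nonexpansive (R : realType) (k : nat) (rho : R)
    (T : 'rV[R]_k -> 'rV[R]_k) : Prop :=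
  [/\ 0 <= rho,
      Fix T !=set0 &
      forall x z : 'rV[R]_k, Fix T z ->
        enorm (T x - z) ^+ 2
        <= enorm (x - z) ^+ 2 - rho * enorm (T x - x) ^+ 2].

Definition demiclosedness_principle (R : realType) (k : nat)
    (T : 'rV[R]_k -> 'rV[R]_k) : Prop :=
  forall (w : nat -> 'rV[R]_k) (l : 'rV[R]_k),
    converges_to w l ->
    enorm (T (w n) - w n) @[n --> \oo] --> (0 : R) ->
    Fix T l.

Definition strongly_convex (R : realType) (k : nat) (sigma : R)
    (f : 'rV[R]_k -> R) : Prop :=
  forall (x y : 'rV[R]_k) (a : R), 0 <= a <= 1 ->
    f (a *: x + (1 - a) *: y)
    <= a * f x + (1 - a) * f y
       - sigma / 2 * a * (1 - a) * enorm (x - y) ^+ 2.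

Definition subdifferential (R : realType) (k : nat) (phi : 'rV[R]_k -> R)
    (x : 'rV[R]_k) : set 'rV[R]_k :=
  [set u | forall y : 'rV[R]_k, dot u (y - x) <= phi y - phi x].

Definition solution_set (R : realType) (k : nat)
    (T : 'rV[R]_k -> 'rV[R]_k) (f g : 'rV[R]_k -> R) : set 'rV[R]_k :=
  [set x | Fix T x /\ forall y : 'rV[R]_k, Fix T y -> f x / g x <= f y / g y].

Definition AFSSM_step (R : realType) (k : nat)
    (T : 'rV[R]_k -> 'rV[R]_k) (f g : 'rV[R]_k -> R) (eta : R)
    (x x' : 'rV[R]_k) : Prop :=
  exists f' h' : 'rV[R]_k,
    let theta := f x / g x in
    let d := f' + theta *: h' in
    [/\ subdifferential f x f',
        subdifferential (fun y => - g y) x h' &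
        x' = T (x - (eta / Num.max 1 (enorm d)) *: d)].

(* Sequences are indexed from 1; the values at index 0 play no role. *)
Definition AFSSM (R : realType) (k : nat)
    (T : 'rV[R]_k -> 'rV[R]_k) (f g : 'rV[R]_k -> R) (eta : nat -> R)
    (x : nat -> 'rV[R]_k) : Prop :=
  [/\ range T (x 1%N),
      0 < g (x 1%N) &
      forall n : nat, (1 <= n)%N -> AFSSM_step T f g (eta n) (x n) (x n.+1)].

(* Main.v *)
(* For a solution z put a_n = |x_n - z|^2, y_n = x_n - lambda_n d_n with
   lambda_n = eta_n / max(1, |d_n|), and c_n = f z - theta_n g z - sigma/2 a_n.
   Strong convexity of f and strong quasi-nonexpansiveness of T give
     a_(n+1) <= a_n + 2 lambda_n c_n + eta_n^2 - rho |T y_n - y_n|^2.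
   As theta_n >= 0, this makes (x_n) bounded. Fix e > 0 and let a_n >= e with n
   large. If |T y_n - y_n| is not small, the last term outweighs the middle ones,
   which are O(eta_n). If it is small, x_n is close to Fix T, where the quotient
   f / g is at least f z / g z; hence c_n <= - sigma e / 4 and theta_n is bounded,
   so that lambda_n is at least a constant times eta_n. In both cases
   a_(n+1) <= a_n - c eta_n for some c > 0, and a_n -> 0 because the sum of the
   eta_n diverges. Since z was any solution, the solution is unique. *)

Require Import Defs.
From HB Require Import structures.
From mathcomp Require Import all_boot all_order all_algebra.
From mathcomp Require Import all_classical all_reals all_analysis.
From mathcomp Require Import ring lra.

Set Implicit Arguments.
Unset Strict Implicit.
Unset Printing Implicit Defensive.

Import Order.TTheory GRing.Theory Num.Theory.
Import numFieldNormedType.Exports.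

Local Open Scope classical_set_scope.
Local Open Scope ring_scope.

(** * Euclidean inner product and norm *)

Lemma dotC (R : realType) (k : nat) (u v : 'rV[R]_k) : dot u v = dot v u.
Proof. by apply: eq_bigr => i _; rewrite mulrC. Qed.

Lemma dotDl (R : realType) (k : nat) (u v w : 'rV[R]_k) :
  dot (u + v) w = dot u w + dot v w.
Proof. by rewrite -big_split; apply: eq_bigr => i _; rewrite mxE mulrDl. Qed.

Lemma dotZl (R : realType) (k : nat) (c : R) (u v : 'rV[R]_k) :
  dot (c *: u) v = c * dot u v.
Proof. by rewrite mulr_sumr; apply: eq_bigr => i _; rewrite mxE mulrA. Qed.

Lemma dotDr (R : realType) (k : nat) (u v w : 'rV[R]_k) :
  dot u (v + w) = dot u v + dot u w.
Proof. by rewrite dotC dotDl !(dotC u). Qed.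

Lemma dotZr (R : realType) (k : nat) (c : R) (u v : 'rV[R]_k) :
  dot u (c *: v) = c * dot u v.
Proof. by rewrite dotC dotZl dotC. Qed.

Lemma dotNl (R : realType) (k : nat) (u v : 'rV[R]_k) :
  dot (- u) v = - dot u v.
Proof. by rewrite -scaleN1r dotZl mulN1r. Qed.

Lemma dotNr (R : realType) (k : nat) (u v : 'rV[R]_k) :
  dot u (- v) = - dot u v.
Proof. by rewrite dotC dotNl dotC. Qed.

Definition dotE := (dotDl, dotDr, dotNl, dotNr, dotZl, dotZr).

Lemma dot_ge0 (R : realType) (k : nat) (u : 'rV[R]_k) : 0 <= dot u u.
Proof. by apply: sumr_ge0 => i _; rewrite -expr2 sqr_ge0. Qed.

Lemma enorm_ge0 (R : realType) (k : nat) (u : 'rV[R]_k) : 0 <= enorm u.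
Proof. exact: sqrtr_ge0. Qed.

Lemma enorm_sqr (R : realType) (k : nat) (u : 'rV[R]_k) :
  enorm u ^+ 2 = dot u u.
Proof. by rewrite sqr_sqrtr// dot_ge0. Qed.

Lemma enorm_coord (R : realType) (k : nat) (u : 'rV[R]_k) (i : 'I_k) :
  `|u ord0 i| <= enorm u.
Proof.
rewrite -sqrtr_sqr ler_sqrt ?dot_ge0// expr2 /dot (bigD1 i)//=.
by rewrite lerDl sumr_ge0// => j _; rewrite -expr2 sqr_ge0.
Qed.

Lemma enorm0_eq0 (R : realType) (k : nat) (u : 'rV[R]_k) :
  enorm u = 0 -> u = 0.
Proof.
move=> u0; apply/rowP => i; apply/eqP.
by rewrite mxE -normr_le0 -u0 enorm_coord.
Qed.

Lemma enormZ (R : realType) (k : nat) (c : R) (u : 'rV[R]_k) :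
  enorm (c *: u) = `|c| * enorm u.
Proof.
by rewrite /enorm dotZl dotZr mulrA -expr2 sqrtrM ?sqr_ge0// sqrtr_sqr.
Qed.

Lemma enormN (R : realType) (k : nat) (u : 'rV[R]_k) : enorm (- u) = enorm u.
Proof. by rewrite -scaleN1r enormZ normrN1 mul1r. Qed.

Lemma enormB (R : realType) (k : nat) (u v : 'rV[R]_k) :
  enorm (u - v) = enorm (v - u).
Proof. by rewrite -enormN opprB. Qed.

Lemma cauchy_schwarz (R : realType) (k : nat) (u v : 'rV[R]_k) :
  dot u v <= enorm u * enorm v.
Proof.
have [u0|u0] := eqVneq (enorm u) 0.
  by rewrite (enorm0_eq0 u0) -(scale0r 0) dotZl enormZ normr0 !mul0r.
have [v0|v0] := eqVneq (enorm v) 0.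
  by rewrite (enorm0_eq0 v0) -(scale0r 0) dotZr enormZ normr0 !mul0r mulr0.
(* Expanding this square gives twice [enorm u * enorm v] times the gap in the inequality; the
   positive factor is then cancelled. *)
have := dot_ge0 (enorm v *: u - enorm u *: v).
rewrite !dotE (dotC v u) -!enorm_sqr.
have : 0 < enorm u * enorm v.
  by rewrite mulr_gt0// lt_neqAle eq_sym enorm_ge0 ?u0 ?v0.
set a := enorm u; set b := enorm v => ab h.
by rewrite -(ler_pM2l ab); nra.
Qed.

Lemma enormD (R : realType) (k : nat) (u v : 'rV[R]_k) :
  enorm (u + v) <= enorm u + enorm v.
Proof.
rewrite -(@ler_pXn2r _ 2)// ?nnegrE ?addr_ge0 ?enorm_ge0//.
rewrite sqrrD !enorm_sqr !dotE (dotC v u).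
by have := cauchy_schwarz u v; lra.
Qed.

Lemma enorm_triangle (R : realType) (k : nat) (u v w : 'rV[R]_k) :
  enorm (u - w) <= enorm (u - v) + enorm (v - w).
Proof. by have := enormD (u - v) (v - w); rewrite addrA subrK. Qed.

Lemma enorm_le_sum (R : realType) (k : nat) (u : 'rV[R]_k) :
  enorm u <= \sum_(i < k) `|u ord0 i|.
Proof.
rewrite {1}[u]row_sum_delta.
elim/big_ind2 : _ => [|a x b y xa yb|i _].
- by rewrite -(scale0r 0) enormZ normr0 mul0r.
- exact: le_trans (enormD _ _) (lerD xa yb).
rewrite enormZ ler_piMr// /enorm /dot (bigD1 i)//= big1 => [|j /negPf ji].
  by rewrite !mxE !eqxx mulr1 addr0 sqrtr1.
by rewrite !mxE ji mul0r.
Qed.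

(** A cluster point in the compact box [[-B, B]^k] is approximated within [1/(m+1)] in every
    coordinate at some index beyond [m]. The selection [phi] need not be increasing: [n <= phi n]
    already makes it tend to infinity. *)
Lemma bolzano_weierstrass (R : realType) (k : nat) (u : nat -> 'rV[R]_k)
    (B : R) :
  (forall n, enorm (u n) <= B) ->
  exists w (phi : nat -> nat),
    (forall n, (n <= phi n)%N) /\ converges_to (u \o phi) w.
Proof.
move=> uB.
pose A := [set v : 'rV[R]_k | forall i, v ord0 i \in `[- B, B]].
have cA : compact A.
  apply: (@rV_compact _ _ (fun=> `[- B, B]%classic)) => _.
  exact: segment_compact.
have [w [_ cw]] : A `&` cluster (u @ \oo) !=set0.
  apply: cA; exists 0%N => // n _ i.
  by rewrite in_itv/= -ler_norml (le_trans (enorm_coord _ _)).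
have near_w (m : nat) : exists n,
    (m <= n)%N /\ forall i, `|w ord0 i - u n ord0 i| < m.+1%:R^-1.
  have um : (u @ \oo) (u @` [set n | (m <= n)%N]).
    by exists m => // n /= mn; exists n.
  have m0 : (0 : R) < m.+1%:R^-1 by rewrite invr_gt0.
  have [_ [[n mn <-] [_ wn]]] := cw _ _ um (nbhsx_ballx w _ m0).
  by exists n; split => // i; exact: wn.
have [phi phiP] := choice near_w.
exists w, phi; split => [n|]; first by have [] := phiP n.
apply: (@squeeze_cvgr _ _ _ _ (fun=> 0) (fun n => k%:R * n.+1%:R^-1)).
- apply: nearW => n; rewrite enorm_ge0/= (le_trans (enorm_le_sum _))//.
  rewrite mulr_natl -[X in _ *+ X]card_ord -sumr_const ler_sum// => i _.
  by rewrite !mxE distrC ltW//; have [_] := phiP n; exact.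
- exact: cvg_cst.
- rewrite -(mulr0 k%:R); apply: cvgMr; exact: cvg_harmonic.
Qed.

(** * Convex functions: local bounds, Lipschitz continuity, subgradients *)

Lemma convex_functionE (R : realType) (k : nat) (phi : 'rV[R]_k -> R) :
  convex_function [set: 'rV[R]_k] phi ->
  forall (x y : 'rV[R]_k) (a : R), 0 <= a <= 1 ->
    phi (a *: x + (1 - a) *: y) <= a * phi x + (1 - a) * phi y.
Proof.
move=> cphi x y a /andP[a0 a1].
by have := cphi (Itv01 a0 a1) x y; rewrite !in_setT; apply.
Qed.

Lemma convex_midpoint (R : realType) (k : nat) (phi : 'rV[R]_k -> R)
    (x y : 'rV[R]_k) :
  convex_function [set: 'rV[R]_k] phi ->
  phi (2^-1 *: (x + y)) <= 2^-1 * (phi x + phi y).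
Proof.
move=> /convex_functionE/(_ x y 2^-1).
rewrite invr_ge0 ler0n invf_le1 ?ltr0n// ler1n => /(_ isT).
have -> : 1 - 2^-1 = 2^-1 :> R by field.
by rewrite scalerDr mulrDr.
Qed.

Lemma convex_line_bound (R : realType) (k : nat) (phi : 'rV[R]_k -> R)
    (v : 'rV[R]_k) (r : R) :
  convex_function [set: 'rV[R]_k] phi -> 0 < r ->
  exists B, forall c, `|c| <= r -> phi (c *: v) <= B.
Proof.
move=> /convex_functionE cphi r0.
exists (`|phi (r *: v)| + `|phi (- r *: v)|) => c.
rewrite ler_norml => /andP[rc cr].
have r20 : 0 < r + r by rewrite addr_gt0.
have t0 : 0 <= (c + r) / (r + r) by rewrite divr_ge0 ?(ltW r20)//; lra.
have t1 : (c + r) / (r + r) <= 1 by rewrite ler_pdivrMr//; lra.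
have := cphi (r *: v) (- r *: v) ((c + r) / (r + r)).
rewrite t0 t1 => /(_ isT).
rewrite !scalerA -scalerDl.
have -> : (c + r) / (r + r) * r + (1 - (c + r) / (r + r)) * - r = c.
  by field; lra.
move=> /le_trans; apply.
rewrite lerD// (le_trans (ler_norm _))// normrM ler_piMl//.
  by rewrite ger0_norm.
by rewrite ger0_norm; lra.
Qed.

(** Induction on the coordinates: a sum is the midpoint of its doubled first term, which lies on a
    line, and its doubled remainder. The doubling is why the radius must stay general in the
    induction. *)
Lemma convex_box_bound (R : realType) (k : nat) (phi : 'rV[R]_k -> R)
    (s : seq 'I_k) :
  convex_function [set: 'rV[R]_k] phi ->
  forall r, 0 < r -> exists B, forall a : 'I_k -> R, (forall i, `|a i| <= r) ->
    phi (\sum_(i <- s) a i *: delta_mx ord0 i) <= B.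
Proof.
move=> cphi; elim: s => [|i s IH] r r0.
  by exists (phi 0) => a _; rewrite big_nil.
have r20 : 0 < 2 * r by rewrite mulr_gt0.
have [B1 B1P] := convex_line_bound (delta_mx ord0 i) cphi r20.
have [B2 B2P] := IH _ r20.
exists (2^-1 * (B1 + B2)) => a ar; rewrite big_cons.
have a2r j : `|2 * a j| <= 2 * r by rewrite normrM ger0_norm// ler_pM2l.
have -> : a i *: delta_mx ord0 i + \sum_(j <- s) a j *: delta_mx ord0 j =
    2^-1 *: ((2 * a i) *: delta_mx ord0 i +
             \sum_(j <- s) (2 * a j) *: delta_mx ord0 j) :> 'rV[R]_k.
  rewrite scalerDr scalerA mulKf// scaler_sumr; congr (_ + _).
  by apply: eq_bigr => j _; rewrite scalerA mulKf.
rewrite (le_trans (convex_midpoint _ _ cphi))// ler_pM2l ?invr_gt0//.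
by rewrite lerD ?B1P ?B2P.
Qed.

(** The ball lies in a box, which gives the upper bound [B]. Reflection turns it into a lower bound:
    [0] is the midpoint of [x] and [- x], so [phi x >= 2 * phi 0 - B]. *)
Lemma convex_ball_bound (R : realType) (k : nat) (phi : 'rV[R]_k -> R) (r : R) :
  convex_function [set: 'rV[R]_k] phi ->
  exists B, forall x, enorm x <= r -> `|phi x| <= B.
Proof.
move=> cphi.
have r0 : 0 < `|r| + 1 by rewrite ltr_wpDl.
have [B BP] := convex_box_bound (index_enum 'I_k) cphi r0.
have le_B x : enorm x <= r -> phi x <= B.
  move=> xr; rewrite [x]row_sum_delta; apply: BP => i.
  by rewrite (le_trans (enorm_coord _ _))// (le_trans xr)// ler_wpDr// ler_norm.
exists (`|B| + `|2 * phi 0 - B|) => x xr.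
have /le_B Nx : enorm (- x) <= r by rewrite enormN.
have := convex_midpoint x (- x) cphi; rewrite subrr scaler0.
move=> h; have := le_B _ xr => xB.
have := ler_norm B; have := ler_norm (- (2 * phi 0 - B)).
have := normr_ge0 B; have := normr_ge0 (2 * phi 0 - B); rewrite normrN.
rewrite ler_norml; lra.
Qed.

(** Prolong the segment from [y] to [x] by unit length to a point [z], still in the ball of radius
    [r + 1]. Then [x] is a convex combination of [z] and [y] with weight [s / (1 + s)] on [z], and
    boundedness of [phi] on the larger ball bounds the slope. *)
Lemma convex_ball_lipschitz (R : realType) (k : nat) (phi : 'rV[R]_k -> R)
    (r : R) :
  convex_function [set: 'rV[R]_k] phi ->
  exists2 C, 0 <= C & forall x y, enorm x <= r -> enorm y <= r ->
    `|phi x - phi y| <= C * enorm (x - y).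
Proof.
move=> cphi; have [B BP] := convex_ball_bound (r + 1) cphi.
suff lip x y : enorm x <= r -> enorm y <= r ->
    phi x - phi y <= (2 * `|B|) * enorm (x - y).
  exists (2 * `|B|); first by rewrite mulr_ge0.
  move=> x y xr yr; rewrite ler_norml lip// andbT.
  by rewrite lerNl opprB enormB lip.
move=> xr yr; set s := enorm (x - y).
have [s0|s0] := eqVneq s 0.
  by rewrite s0 mulr0 (subr0_eq (enorm0_eq0 s0)) subrr.
have {}s0 : 0 < s by rewrite lt_neqAle eq_sym s0 enorm_ge0.
pose z := x + s^-1 *: (x - y).
have zr : enorm z <= r + 1.
  rewrite (le_trans (enormD _ _))// lerD// enormZ -/s gtr0_norm ?invr_gt0//.
  by rewrite mulVf ?gt_eqF.
have s10 : 0 < 1 + s by rewrite addr_gt0.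
have := convex_functionE cphi z y (a := s / (1 + s)).
have -> : s / (1 + s) *: z + (1 - s / (1 + s)) *: y = x.
  have -> : 1 - s / (1 + s) = (1 + s)^-1 by field; lra.
  rewrite scalerDr scalerA mulrAC mulfV ?gt_eqF// mul1r scalerBr.
  rewrite addrA subrK -scalerDl.
  by rewrite (_ : _ + _ = 1) ?scale1r//; field; lra.
rewrite divr_ge0 ?(ltW s0) ?(ltW s10)//= ler_pdivrMr// mul1r.
move=> /(_ ltac:(lra)).
rewrite -(ler_pM2r s10).
have -> : (s / (1 + s) * phi z + (1 - s / (1 + s)) * phi y) * (1 + s) =
  s * phi z + phi y by field; lra.
have xr1 : enorm x <= r + 1 by lra.
have := BP _ zr; have := BP _ xr1.
rewrite !ler_norml => /andP[h1 h2] /andP[h3 h4].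
have := ler_norm B => hB h.
have : s * (phi z - phi x) <= s * (2 * `|B|) by rewrite ler_pM2l//; lra.
lra.
Qed.

Lemma convex_converges (R : realType) (k : nat) (phi : 'rV[R]_k -> R)
    (u : nat -> 'rV[R]_k) (w : 'rV[R]_k) (r : R) :
  convex_function [set: 'rV[R]_k] phi -> (forall n, enorm (u n) <= r) ->
  converges_to u w -> phi (u n) @[n --> \oo] --> phi w.
Proof.
move=> cphi ur uw.
(* The radius is enlarged so that the ball visibly contains the limit [w] too. *)
have [C C0 CP] := convex_ball_lipschitz (Num.max r (enorm w)) cphi.
apply/subr_cvg0/norm_cvg0P.
apply: (@squeeze_cvgr _ _ _ _ (fun=> 0) (fun n => C * enorm (u n - w))).
- apply: nearW => n; rewrite normr_ge0/= CP// le_max ?lexx ?orbT//.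
  by rewrite ur.
- exact: cvg_cst.
- by rewrite -(mulr0 C); exact: cvgMr.
Qed.

(** Testing the subgradient inequality one unit away from [x] in the direction of [u] bounds
    [enorm u] by a Lipschitz constant on the ball of radius [r + 1]. *)
Lemma subdifferential_ball_bound (R : realType) (k : nat)
    (phi : 'rV[R]_k -> R) (r : R) :
  convex_function [set: 'rV[R]_k] phi ->
  exists2 C, 0 <= C & forall x u, enorm x <= r -> subdifferential phi x u ->
    enorm u <= C.
Proof.
move=> cphi; have [C C0 CP] := convex_ball_lipschitz (r + 1) cphi.
exists C => // x u xr uP; have [->//|u0] := eqVneq (enorm u) 0.
have {}u0 : 0 < enorm u by rewrite lt_neqAle eq_sym u0 enorm_ge0.
have n1 : enorm ((enorm u)^-1 *: u) = 1.
  by rewrite enormZ gtr0_norm ?invr_gt0// mulVf ?gt_eqF.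
have := uP (x + (enorm u)^-1 *: u).
rewrite addrAC subrr add0r dotZr -enorm_sqr expr2 mulKf ?gt_eqF//.
move=> /le_trans; apply.
apply: le_trans (ler_norm _) _; apply: le_trans (CP _ _ _ _) _.
- by rewrite (le_trans (enormD _ _))// n1 lerD2r.
- by rewrite (le_trans xr)// lerDl.
- by rewrite addrAC subrr add0r n1 mulr1.
Qed.

(* Comparing x with the points x + a (y - x) and letting a tend to 0. *)
Lemma strongly_convex_subdifferential (R : realType) (k : nat) (sigma : R)
    (f : 'rV[R]_k -> R) (x u y : 'rV[R]_k) :
  strongly_convex sigma f -> subdifferential f x u ->
  dot u (y - x) <= f y - f x - sigma / 2 * enorm (y - x) ^+ 2.
Proof.
move=> sf uP; rewrite -subr_le0.
set q := sigma / 2 * enorm (y - x) ^+ 2; set D := (X in X <= 0).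
have Da a : 0 < a -> a <= 1 -> D <= a * q.
  move=> a0 a1; have := sf y x a; rewrite (ltW a0) a1 => /(_ isT).
  have := uP (a *: y + (1 - a) *: x).
  have -> : a *: y + (1 - a) *: x - x = a *: (y - x).
    by rewrite scalerBl scale1r scalerBr addrCA addrAC subrr add0r.
  rewrite dotZr => h1.
  have -> : sigma / 2 * a * (1 - a) * enorm (y - x) ^+ 2 = a * (1 - a) * q.
    by rewrite /q; ring.
  by move=> h2; rewrite -(ler_pM2l a0) /D; lra.
rewrite leNgt; apply/negP => D0.
have q0 : 0 < q by have := Da 1 ltr01 (lexx _); lra.
have Dq : D <= q by have := Da 1 ltr01 (lexx _); lra.
have q20 : 0 < 2 * q by lra.
(* This value of [a] is at most 1 because [D <= q], and it yields [D <= D / 2], against [0 < D]. *)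
have := Da (D / (2 * q)); rewrite divr_gt0// => /(_ isT).
rewrite ler_pdivrMr// mul1r => /(_ ltac:(lra)).
have -> : D / (2 * q) * q = D / 2 by field; lra.
lra.
Qed.

(** * Real recurrences and stepsize series *)

Lemma recurrence_bounded (R : realType) (a eta : nat -> R) (K S : R) :
  (forall n, \sum_(i < n) eta i ^+ 2 <= S) ->
  (forall n, a n.+1 <= Num.max K (a n) + eta n ^+ 2) ->
  forall n, a n <= Num.max K (a 0%N) + S.
Proof.
move=> etaS rec n.
suff : a n <= Num.max K (a 0%N) + \sum_(i < n) eta i ^+ 2.
  by move=> /le_trans; apply; rewrite lerD2l.
elim: n => [|n IH]; first by rewrite big_ord0 addr0 le_max lexx orbT.
rewrite big_ord_recr/= addrA (le_trans (rec n))// lerD2r.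
rewrite ge_max IH andbT (@le_trans _ _ (Num.max K (a 0%N)))//.
  by rewrite le_max lexx.
by rewrite lerDl sumr_ge0// => i _; rewrite sqr_ge0.
Qed.

(** Divergence of the sum of [eta] forces [a] below [e / 2] at some late index. From there it never
    exceeds [e]: below [e / 2] one step adds at most [e / 2], and above [e / 2] it decreases. *)
Lemma recurrence_cvg0 (R : realType) (a eta : nat -> R) (F : R) :
  (forall n, 0 <= a n) -> (forall n, 0 < eta n) -> 0 <= F ->
  eta @ \oo --> (0 : R) ->
  (forall A : R, exists n, A < \sum_(i < n) eta i) ->
  (forall n, a n.+1 <= a n + 2 * eta n * F + eta n ^+ 2) ->
  (forall e : R, 0 < e -> exists2 c, 0 < c &
    \forall n \near \oo, e <= a n -> a n.+1 <= a n - c * eta n) ->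
  a @ \oo --> (0 : R).
Proof.
move=> a0 eta0 F0 etacvg sumeta growth decrease.
apply/cvgrPdist_le => e e0.
have e20 : 0 < e / 2 by rewrite divr_gt0.
have [c c0 [N1 _ dec]] := decrease _ e20.
(* For [eta n] below this threshold, [2 * eta n * F + eta n ^+ 2 <= eta n * (2 * F + 1) <= e /
   2]. *)
have d0 : 0 < Num.min 1 (e / 2 / (2 * F + 1)).
  by rewrite lt_min ltr01 divr_gt0// ltr_wpDl// mulr_ge0.
have /cvgrPdist_le/(_ _ d0)[N2 _ small] := etacvg.
pose N := maxn N1 N2.
have decN n : (N <= n)%N -> e / 2 <= a n -> a n.+1 <= a n - c * eta n.
  by move=> Nn; apply: dec; rewrite /= (leq_trans _ Nn)// leq_maxl.
have growN n : (N <= n)%N -> a n.+1 <= a n + e / 2.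
  move=> Nn; have /= := small n (leq_trans (leq_maxr _ _) Nn).
  rewrite sub0r normrN gtr0_norm// le_min => /andP[h1].
  rewrite ler_pdivlMr ?ltr_wpDl ?mulr_ge0// => h2.
  rewrite (le_trans (growth n))// -addrA lerD2l.
  by have := eta0 n; nra.
have [m [Nm am]] : exists m, (N <= m)%N /\ a m < e / 2.
  apply: contrapT => /forallNP none.
  have big n : e / 2 <= a (N + n)%N.
    rewrite leNgt; apply/negP => h; apply: (none (N + n)%N).
    by rewrite leq_addr.
  have desc n : a (N + n)%N <=
      a N - c * (\sum_(i < N + n) eta i - \sum_(i < N) eta i).
    elim: n => [|n IH]; first by rewrite addn0 subrr mulr0 subr0.
    rewrite addnS (le_trans (decN _ (leq_addr _ _) (big n)))// big_ord_recr/=.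
    by move: IH; lra.
  (* Past this partial sum the accumulated decrease exceeds [a N], so [a] would become negative. *)
  have [n hn] := sumeta (a N / c + \sum_(i < N) eta i).
  have mono : \sum_(i < n) eta i <= \sum_(i < N + n) eta i.
    rewrite -!(big_mkord xpredT eta).
    rewrite (big_cat_nat (n := n) (p := N + n))//= ?leq_addl//.
    by rewrite lerDl sumr_ge0// => i _; exact: ltW.
  have := lt_le_trans hn mono; rewrite -ltrBrDr ltr_pdivrMr// => h.
  by have := desc n; have := a0 (N + n)%N; lra.
have bound n : a (m + n)%N <= e.
  elim: n => [|n IH]; first by rewrite addn0; lra.
  have Nmn : (N <= m + n)%N by rewrite (leq_trans Nm)// leq_addr.
  rewrite addnS; have [h|h] := leP (e / 2) (a (m + n)%N).
    by have := decN _ Nmn h; have := mulr_gt0 c0 (eta0 (m + n)%N); lra.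
  by have := growN _ Nmn; lra.
exists m => // n /= mn.
by rewrite sub0r normrN ger0_norm// -(subnKC mn) bound.
Qed.

Lemma shifted_sum_unbounded (R : realType) (eta : nat -> R) :
  (forall n, (1 <= n)%N -> 0 < eta n) ->
  (\sum_(1 <= n <oo) (eta n)%:E = +oo)%E ->
  forall A : R, exists n, A < \sum_(i < n) eta i.+1.
Proof.
move=> eta0 sum_eta A; apply: contrapT => /forallNP h.
suff : (\sum_(1 <= n <oo) (eta n)%:E <= A%:E)%E by rewrite sum_eta leye_eq.
apply: lime_le.
  by apply: is_cvg_nneseries => n n1 _; rewrite lee_fin ltW// eta0.
apply: nearW => n; rewrite sumEFin lee_fin leNgt; apply/negP => An.
(* The sum over [1 <= i < n] has [n.-1] terms once reindexed from 0. *)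
apply: (h n.-1); case: n An => [|n]; first by rewrite big_geq ?big_ord0.
by rewrite big_add1/= big_mkord.
Qed.

Lemma shifted_sum_sqr_bounded (R : realType) (eta : nat -> R) :
  (\sum_(1 <= n <oo) (eta n ^+ 2)%:E < +oo)%E ->
  exists S, forall n, \sum_(i < n) eta i.+1 ^+ 2 <= S.
Proof.
move=> sum_eta; exists (fine (\sum_(1 <= n <oo) (eta n ^+ 2)%:E)%E) => n.
have sq0 i : (0 <= (eta i ^+ 2)%:E)%E by rewrite lee_fin sqr_ge0.
rewrite -lee_fin fineK; last by rewrite ge0_fin_numE// nneseries_ge0.
rewrite -(big_mkord xpredT (fun i => eta i.+1 ^+ 2)).
rewrite -(big_add1 _ _ _ n.+1 xpredT (fun i => eta i ^+ 2)).
by rewrite -sumEFin nneseries_lim_ge.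
Qed.

Lemma sum_sqr_bounded_cvg0 (R : realType) (eta : nat -> R) (S : R) :
  (forall n, \sum_(i < n) eta i ^+ 2 <= S) -> eta @ \oo --> (0 : R).
Proof.
move=> etaS.
have /cvg_series_cvg_0 /cvgrPdist_le cv : cvgn (series (fun i => eta i ^+ 2)).
  apply: nondecreasing_is_cvgn.
    by apply: nondecreasing_series => i _ _; rewrite sqr_ge0.
  by exists S => _ [n _ <-]; rewrite /series/= big_mkord.
apply/cvgrPdist_le => e e0; near=> n.
rewrite -(@ler_pXn2r _ 2)// ?nnegrE ?(ltW e0)// sub0r normrN.
rewrite real_normK ?num_real//.
have : `|0 - eta n ^+ 2| <= e ^+ 2 by near: n; apply: cv; rewrite exprn_gt0.
by rewrite sub0r normrN ger0_norm ?sqr_ge0.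
Unshelve. all: by end_near. Qed.

(** * One step of the method *)

(** Expand the squared distance from [y = x - lam *: d] to [z] and bound [dot d (z - x)] by adding
    the strong-convexity inequality for [f] to [theta >= 0] times the subgradient inequality for
    [- g]; [theta * g x = f x] cancels the values at [x]. The lower bound on [lam] comes from
    [enorm d <= Cf + theta * Cg]. *)
Lemma AFSSM_step_dist (R : realType) (k : nat)
    (T : 'rV[R]_k -> 'rV[R]_k) (f g : 'rV[R]_k -> R) (rho sigma eta Cf Cg : R)
    (x x' z : 'rV[R]_k) :
  strongly_quasi_nonexpansive rho T -> strongly_convex sigma f ->
  Fix T z -> 0 <= f x -> 0 < g x -> 0 < eta -> 0 <= Cg ->
  (forall u, subdifferential f x u -> enorm u <= Cf) ->
  (forall u, subdifferential (fun y => - g y) x u -> enorm u <= Cg) ->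
  AFSSM_step T f g eta x x' ->
  exists (y : 'rV[R]_k) (lam : R),
    [/\ x' = T y, enorm (y - x) <= eta, 0 < lam <= eta,
        eta <= lam * (1 + Cf + f x / g x * Cg) &
        enorm (x' - z) ^+ 2 <= enorm (x - z) ^+ 2
          + 2 * lam * (f z - f x / g x * g z - sigma / 2 * enorm (x - z) ^+ 2)
          + eta ^+ 2 - rho * enorm (T y - y) ^+ 2].
Proof.
move=> [_ _ hT] fs Tz fx0 gx0 eta0 Cg0 hCf hCg [f' [h' /=]].
set theta := f x / g x; set d := f' + theta *: h' => -[hf' hh' ->].
set m := Num.max 1 (enorm d); pose lam := eta / m.
have theta0 : 0 <= theta by rewrite divr_ge0// ltW.
have m1 : 1 <= m by rewrite le_max lexx.
have dm : enorm d <= m by rewrite le_max lexx orbT.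
have m0 : 0 < m by rewrite (lt_le_trans _ m1).
have lam0 : 0 < lam by rewrite divr_gt0.
have lamd : lam * enorm d <= eta.
  by rewrite /lam mulrAC ler_pdivrMr// ler_pM2l.
have Cf0 : 0 <= Cf by rewrite (le_trans (enorm_ge0 _) (hCf _ hf')).
have mC : m <= 1 + Cf + theta * Cg.
  have tC : 0 <= theta * Cg by rewrite mulr_ge0.
  have dC : enorm d <= Cf + theta * Cg.
    rewrite (le_trans (enormD _ _))// lerD ?hCf// enormZ ger0_norm//.
    by rewrite ler_wpM2l ?hCg.
  by rewrite ge_max; apply/andP; split; lra.
exists (x - lam *: d), lam; split => //.
- by rewrite addrAC subrr add0r enormN enormZ gtr0_norm.
- by rewrite lam0 ler_pdivrMr// ler_peMr// ltW.
- by rewrite -{1}(divfK (lt0r_neq0 m0) eta) ler_pM2l.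
apply: le_trans (hT _ _ Tz) _; rewrite lerD2r.
have hd : dot d (z - x) <=
    f z - theta * g z - sigma / 2 * enorm (x - z) ^+ 2.
  have h1 := strongly_convex_subdifferential z fs hf'.
  have h2 : theta * dot h' (z - x) <= theta * (- g z - - g x).
    by rewrite ler_wpM2l//; exact: hh'.
  have tg : theta * g x = f x by rewrite divfK ?gt_eqF.
  rewrite dotDl dotZl (enormB x); lra.
have -> : enorm (x - lam *: d - z) ^+ 2 = enorm (x - z) ^+ 2
    + 2 * lam * dot d (z - x) + (lam * enorm d) ^+ 2.
  rewrite addrAC exprMn !enorm_sqr -(opprB x z).
  rewrite !(dotDl (x - z)) !(dotDr _ (x - z)).
  rewrite !dotNl !dotNr !dotZl !dotZr (dotC (x - z) d); ring.
have le1 : 2 * lam * dot d (z - x) <= 2 * lam *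
    (f z - theta * g z - sigma / 2 * enorm (x - z) ^+ 2).
  by rewrite ler_pM2l// mulr_gt0.
have le2 : (lam * enorm d) ^+ 2 <= eta ^+ 2.
  by rewrite ler_pXn2r// nnegrE ?(ltW eta0)// mulr_ge0 ?enorm_ge0// ltW.
lra.
Qed.

(* Otherwise the offending iterates have a cluster point, which lies in Fix T by
   demi-closedness, so that its quotient is at least that of z. *)
Lemma near_Fix_decrease (R : realType) (k : nat)
    (T : 'rV[R]_k -> 'rV[R]_k) (f g : 'rV[R]_k -> R) (sigma B e : R)
    (X Y : nat -> 'rV[R]_k) (z : 'rV[R]_k) :
  demiclosedness_principle T ->
  convex_function [set: 'rV[R]_k] f ->
  convex_function [set: 'rV[R]_k] (fun y => - g y) ->
  (forall y, Fix T y -> 0 < g y) ->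
  solution_set T f g z ->
  (forall n, enorm (X n) <= B) ->
  enorm (Y n - X n) @[n --> \oo] --> (0 : R) ->
  0 < sigma -> 0 < e ->
  exists (delta tmax : R), 0 < delta /\
    \forall n \near \oo, e <= enorm (X n - z) ^+ 2 ->
      enorm (T (Y n) - Y n) <= delta ->
      f (X n) / g (X n) <= tmax /\
      f z - f (X n) / g (X n) * g z - sigma / 2 * enorm (X n - z) ^+ 2
        <= - (sigma / 4 * e).
Proof.
move=> demi cf cg gpos [Tz zmin] XB YX sigma0 e0.
apply: contrapT => none.
(* The negation is used with [delta = 1 / (m + 1)] and [tmax = m], so residuals vanish along the bad
   indices while the allowed quotient grows without bound. *)
have bad (m : nat) : exists n, (m <= n)%N /\
    [/\ e <= enorm (X n - z) ^+ 2, enorm (T (Y n) - Y n) <= m.+1%:R^-1 &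
      ~ (f (X n) / g (X n) <= m%:R /\
         f z - f (X n) / g (X n) * g z - sigma / 2 * enorm (X n - z) ^+ 2
           <= - (sigma / 4 * e))].
  apply: contrapT => /forallNP good; apply: none.
  exists m.+1%:R^-1, m%:R; split; first by rewrite invr_gt0.
  exists m => // n /= mn en rn; apply: contrapT => Nconcl.
  exact: (good n).
have {none bad}[s sP] := choice bad.
have [w [phi [phi_ge Xw]]] := bolzano_weierstrass (fun n => XB (s n)).
pose i n := s (phi n).
have i_ge n : (n <= i n)%N.
  by rewrite (leq_trans (phi_ge n))//; have [] := sP (phi n).
have i_oo : i @ \oo --> \oo.
  move=> A [N _ NA]; exists N => // n /= Nn.
  by apply: NA; rewrite /= (leq_trans Nn).
have YXi : enorm (Y (i n) - X (i n)) @[n --> \oo] --> (0 : R).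
  exact: (cvg_comp i (fun n => enorm (Y n - X n)) i_oo YX).
have Yw : converges_to (Y \o i) w.
  apply: (@squeeze_cvgr _ _ _ _ (fun=> 0)
    (fun n => enorm (Y (i n) - X (i n)) + enorm (X (i n) - w))).
  - by apply: nearW => n; rewrite enorm_ge0/= enorm_triangle.
  - exact: cvg_cst.
  - by rewrite -(addr0 0); exact: cvgD.
have Tw : Fix T w.
  apply: demi Yw _.
  apply: (@squeeze_cvgr _ _ _ _ (fun=> 0) (fun n => n.+1%:R^-1)).
  - apply: nearW => n; rewrite enorm_ge0/=.
    have [_ [_ /le_trans rn _]] := sP (phi n).
    by apply: rn; rewrite lef_pV2 ?posrE ?ltr0n// ler_nat ltnS.
  - exact: cvg_cst.
  - exact: cvg_harmonic.
have gw := gpos _ Tw.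
have fXw : f (X (i n)) @[n --> \oo] --> f w.
  exact: convex_converges cf (fun n => XB (i n)) Xw.
have gXw : g (X (i n)) @[n --> \oo] --> g w.
  by apply/cvgNP; exact: (convex_converges cg (fun n => XB (i n)) Xw).
have thetaw : f (X (i n)) / g (X (i n)) @[n --> \oo] --> f w / g w.
  by apply: cvgM => //; apply: cvgV => //; rewrite gt_eqF.
(* The squared distance is replaced by its lower bound [e]. The limit of [c] is at most
   [- (sigma / 2 * e)], and the slack down to [sigma / 4] lets the strict inequality pass to late
   terms. *)
pose c n := f z - f (X (i n)) / g (X (i n)) * g z - sigma / 2 * e.
have cw : c @ \oo --> f z - f w / g w * g z - sigma / 2 * e.
  apply: cvgB; last exact: cvg_cst.
  apply: cvgB; first exact: cvg_cst.
  by apply: cvgMl.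
have cw_lt : f z - f w / g w * g z - sigma / 2 * e < - (sigma / 4 * e).
  have : f z <= f w / g w * g z by rewrite -ler_pdivrMr ?zmin ?gpos.
  by have := mulr_gt0 sigma0 e0; lra.
have c_small : \forall n \near \oo, c n < - (sigma / 4 * e).
  exact: cvgr_lt cw _ cw_lt.
have theta_small : \forall n \near \oo,
    f (X (i n)) / g (X (i n)) < f w / g w + 1.
  by apply: cvgr_lt thetaw _ _; rewrite ltrDl.
have [n [cn thn nbig]] : exists n, [/\ c n < - (sigma / 4 * e),
    f (X (i n)) / g (X (i n)) < f w / g w + 1 & f w / g w + 1 <= n%:R].
  near \oo => n; exists n; split; near: n => //.
  exact: nbhs_infty_ger.
(* At this index both bounds hold, with [phi n >= n] in the role of [tmax], which contradicts
   badness. *)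
have [_ [en _]] := sP (phi n); apply; split.
  rewrite (le_trans (ltW thn))// (le_trans nbig)// ler_nat//.
apply: le_trans (ltW cn); rewrite /c lerD2l lerN2 ler_pM2l// divr_gt0//.
Unshelve. all: by end_near. Qed.

(** * Convergence of the iterates *)

Lemma AFSSM_cvg_solution (R : realType) (k : nat)
    (T : 'rV[R]_k -> 'rV[R]_k) (f g : 'rV[R]_k -> R)
    (rho sigma : R) (eta : nat -> R) (x : nat -> 'rV[R]_k) (z : 'rV[R]_k) :
  0 < rho -> strongly_quasi_nonexpansive rho T ->
  convex_function [set: 'rV[R]_k] f ->
  (forall y, range T y -> 0 <= f y) ->
  convex_function [set: 'rV[R]_k] (fun y => - g y) ->
  (forall y, range T y -> 0 < g y) ->
  (forall n, 0 < eta n) ->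
  (forall A : R, exists n, A < \sum_(i < n) eta i) ->
  (exists S, forall n, \sum_(i < n) eta i ^+ 2 <= S) ->
  demiclosedness_principle T -> 0 < sigma -> strongly_convex sigma f ->
  range T (x 0%N) ->
  (forall n, AFSSM_step T f g (eta n) (x n) (x n.+1)) ->
  solution_set T f g z -> converges_to x z.
Proof.
move=> rho0 hT cf f0 cg g0 eta0 sum_eta [S sqrS] demi sigma0 sf x0 step zsol.
have [Tz _] := zsol.
have eta_cvg0 := sum_sqr_bounded_cvg0 sqrS.
have Tx n : range T (x n).
  by case: n => // n; have [f' [h' [_ _ ->]]] := step n; exact: imageT.
have rangeFix y : Fix T y -> range T y by move=> Ty; exists y.
have fz0 : 0 <= f z by apply/f0/rangeFix.
have gz0 : 0 < g z by apply/g0/rangeFix.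
have theta0 n : 0 <= f (x n) / g (x n) by rewrite divr_ge0 ?f0// ltW// g0.
pose a n := enorm (x n - z) ^+ 2.
have a0 n : 0 <= a n by exact: sqr_ge0.
have theta_gz n : 0 <= f (x n) / g (x n) * g z by rewrite mulr_ge0// ltW.
have sa n : 0 <= sigma / 2 * a n by rewrite mulr_ge0// divr_ge0// ltW.
(* A cruder estimate without the quotient and residual terms. No uniform subgradient bound is
   available yet, so constants depending on [n] are used and then forgotten. *)
have basic n : exists2 lam, 0 < lam <= eta n &
    a n.+1 <= a n + 2 * lam * (f z - sigma / 2 * a n) + eta n ^+ 2.
  have [Cf _ CfP] := subdifferential_ball_bound (enorm (x n)) cf.
  have [Cg Cg0 CgP] := subdifferential_ball_bound (enorm (x n)) cg.
  have [y [lam [_ _ /[dup] lame /andP[lam0 _] _ +]]] :=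
    AFSSM_step_dist hT sf Tz (f0 _ (Tx n)) (g0 _ (Tx n)) (eta0 n) Cg0
      (fun u => CfP _ u (lexx _)) (fun u => CgP _ u (lexx _)) (step n).
  move=> h; exists lam => //; apply: le_trans h _.
  have : 0 <= 2 * lam * (f (x n) / g (x n) * g z).
    by rewrite mulr_ge0// mulr_ge0// ltW.
  have : 0 <= rho * enorm (T y - y) ^+ 2 by rewrite mulr_ge0 ?sqr_ge0// ltW.
  by rewrite -/(a n); lra.
have S0 : 0 <= S by have := sqrS 0%N; rewrite big_ord0.
have etaS n : eta n <= 1 + S.
  have : eta n ^+ 2 <= S.
    rewrite (le_trans _ (sqrS n.+1))// big_ord_recr/= lerDr sumr_ge0// => i _.
    exact: sqr_ge0.
  by have := sqr_ge0 (eta n - 1); nra.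
have [A aA] : exists A, forall n, a n <= A.
  (* If [sigma / 2 * a n <= f z], then [a n <= 2 * f z / sigma] and, apart from [eta n ^+ 2], the
     step adds at most [2 * (1 + S) * f z]. Otherwise the middle term is negative. *)
  pose K := 2 * f z / sigma + 2 * (1 + S) * f z.
  exists (Num.max K (a 0%N) + S).
  apply: recurrence_bounded sqrS _ => n.
  have [lam /andP[lam0 lame] h] := basic n.
  apply: le_trans h _; rewrite lerD2r.
  have [small|big] := leP (sigma / 2 * a n) (f z).
    have h1 : lam * (f z - sigma / 2 * a n) <= (1 + S) * f z.
      rewrite ler_pM//; [exact: ltW|by rewrite subr_ge0| |by have := sa n; lra].
      exact: le_trans lame (etaS n).
    have h2 : a n <= 2 * f z / sigma by rewrite ler_pdivlMr//; lra.
    by rewrite le_max /K; apply/orP; left; lra.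
  rewrite le_max; apply/orP; right; rewrite gerDl.
  by rewrite mulr_ge0_le0 ?mulr_ge0 ?(ltW lam0)// subr_le0 ltW.
have xB n : enorm (x n) <= enorm z + (1 + A).
  have := enorm_triangle (x n) z 0; rewrite !subr0.
  by have := aA n; rewrite /a; have := sqr_ge0 (enorm (x n - z) - 1); nra.
(* With the iterates bounded, the subgradient bounds become uniform in [n]. *)
have [Cf Cf0 CfP] := subdifferential_ball_bound (enorm z + (1 + A)) cf.
have [Cg Cg0 CgP] := subdifferential_ball_bound (enorm z + (1 + A)) cg.
have [Y YP] := choice (fun n =>
  AFSSM_step_dist hT sf Tz (f0 _ (Tx n)) (g0 _ (Tx n)) (eta0 n) Cg0
    (fun u => CfP _ u (xB n)) (fun u => CgP _ u (xB n)) (step n)).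
have Yx : enorm (Y n - x n) @[n --> \oo] --> (0 : R).
  apply: (@squeeze_cvgr _ _ _ _ (fun=> 0) eta) => //; last exact: cvg_cst.
  by apply: nearW => n; rewrite enorm_ge0/=; have [lam []] := YP n.
suff : a @ \oo --> (0 : R).
  move=> /(cvg_comp _ _)/(_ (@sqrt_continuous R 0)).
  rewrite sqrtr0; apply: cvg_trans; apply: near_eq_cvg; apply: nearW => n /=.
  by rewrite sqrtr_sqr ger0_norm// enorm_ge0.
apply: (@recurrence_cvg0 _ _ eta (f z)) => //.
  move=> n; have [lam /andP[lam0 lame] h] := basic n; apply: le_trans h _.
  rewrite lerD2r lerD2l -!mulrA ler_pM2l//.
  have := mulr_ge0 (ltW lam0) (sa n).
  have : lam * f z <= eta n * f z by rewrite ler_wpM2r.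
  lra.
move=> e e0.
have [delta [tmax [delta0 near_dec]]] :=
  near_Fix_decrease demi cf cg (fun y Ty => g0 y (rangeFix y Ty)) zsol xB Yx
    sigma0 e0.
(* Bounds [eta n / lam] as long as the quotient is at most [tmax], whose sign is unknown. *)
pose kappa := 1 + Cf + `|tmax| * Cg.
have kappa0 : 0 < kappa by rewrite /kappa -addrA ltr_pwDl// addr_ge0 ?mulr_ge0.
pose c := sigma / 4 * e / kappa.
have c0 : 0 < c by rewrite divr_gt0// mulr_gt0// divr_gt0.
exists (Num.min 1 c); first by rewrite lt_min ltr01.
(* Near [Fix T] the middle term is at most [- 2 * c * eta n], and [eta n <= c] leaves a decrease of
   [c * eta n]. Away from it, [eta n * (2 * f z + 2) < rho * delta ^+ 2] and [eta n <= 1] leave a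
   decrease of [eta n]. *)
pose tau := Num.min (Num.min 1 c) (rho * delta ^+ 2 / (2 * f z + 2)).
have fz2 : 0 < 2 * f z + 2 by rewrite ltr_wpDl// mulr_ge0.
have tau0 : 0 < tau.
  by rewrite !lt_min ltr01 c0 divr_gt0// mulr_gt0// exprn_gt0.
have eta_small : \forall n \near \oo, eta n < tau.
  exact: cvgr_lt eta_cvg0 _ tau0.
near=> n; rewrite -/(a n) => en.
have : eta n < tau by near: n.
rewrite !lt_min => /andP[/andP[eta1 etac]].
rewrite ltr_pdivlMr// => etad.
have [lam [_ _ /andP[lam0 lame] lamk]] := YP n.
rewrite -/(a n) -/(a n.+1) => h.
have en0 := eta0 n.
have minE : Num.min 1 c * eta n <= eta n /\ Num.min 1 c * eta n <= c * eta n.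
  by rewrite -{2}(mul1r (eta n)) !ler_pM2r// !ge_min !lexx orbT.
case: minE => min1 minc.
have [rn|rn] := leP (enorm (T (Y n) - Y n)) delta.
  have near_n : e <= enorm (x n - z) ^+ 2 ->
      enorm (T (Y n) - Y n) <= delta ->
      f (x n) / g (x n) <= tmax /\
      f z - f (x n) / g (x n) * g z - sigma / 2 * enorm (x n - z) ^+ 2
        <= - (sigma / 4 * e) by near: n.
  have [thn cn] := near_n en rn.
  have lk : eta n <= lam * kappa.
    rewrite (le_trans lamk)// ler_pM2l// /kappa lerD2l ler_wpM2r//.
    by rewrite (le_trans thn)// ler_norm.
  have lc : c * eta n <= sigma / 4 * e * lam.
    rewrite /c -[leLHS]mulrA ler_pM2l ?mulr_gt0 ?divr_gt0//.
    by rewrite mulrC ler_pdivrMr.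
  have lcn := ler_wpM2l (ltW lam0) cn; rewrite -/(a n) in lcn.
  have : 0 <= rho * enorm (T (Y n) - Y n) ^+ 2.
    by rewrite mulr_ge0 ?sqr_ge0// ltW.
  have : eta n ^+ 2 <= c * eta n by rewrite expr2 ler_pM2r// ltW.
  lra.
have rd : rho * delta ^+ 2 <= rho * enorm (T (Y n) - Y n) ^+ 2.
  by rewrite ler_pM2l// ler_pXn2r ?nnegrE ?enorm_ge0 ?(ltW delta0)// ltW.
have e2 : eta n ^+ 2 <= eta n by rewrite expr2 ler_piMr// ltW.
have lf : lam * (f z - f (x n) / g (x n) * g z - sigma / 2 * a n) <=
    eta n * f z.
  rewrite (@le_trans _ _ (lam * f z))// ?ler_wpM2r// ler_pM2l//.
  by have := theta_gz n; have := sa n; lra.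
lra.
Unshelve. all: by end_near. Qed.

Theorem theorem11 (R : realType) (k : nat)
  (T : 'rV[R]_k -> 'rV[R]_k) (f g : 'rV[R]_k -> R)
  (rho sigma : R) (eta : nat -> R) (x : nat -> 'rV[R]_k)
  (hrho : 0 < rho)
  (hT : strongly_quasi_nonexpansive rho T)
  (hf : convex_function [set: 'rV[R]_k] f)
  (hf0 : forall y : 'rV[R]_k, range T y -> 0 <= f y)
  (hg : convex_function [set: 'rV[R]_k] (fun y => - g y))
  (hgM : exists2 M : R, 0 < M &
           forall y : 'rV[R]_k, range T y -> 0 < g y <= M)
  (hsol : solution_set T f g !=set0)
  (heta : forall n : nat, (1 <= n)%N -> 0 < eta n)
  (hx : AFSSM T f g eta x)
  (hsum : (\sum_(1 <= n <oo) (eta n)%:E = +oo)%E)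
  (hsum2 : (\sum_(1 <= n <oo) (eta n ^+ 2)%:E < +oo)%E)
  (hdemi : demiclosedness_principle T)
  (hsigma : 0 < sigma)
  (hfs : strongly_convex sigma f) :
  exists2 xs : 'rV[R]_k, solution_set T f g = [set xs] & converges_to x xs.
Proof.
case: hx => Tx1 _ step; case: hgM => M _ hgM.
have g0 y : range T y -> 0 < g y by move=> /hgM/andP[].
have cvg_sol z : solution_set T f g z -> converges_to (fun n => x n.+1) z.
  apply: (@AFSSM_cvg_solution _ _ T f g rho sigma (fun n => eta n.+1)) => //.
  - by move=> n; apply: heta.
  - exact: shifted_sum_unbounded.
  - exact: shifted_sum_sqr_bounded.
  - by move=> n; apply: step.
case: hsol => z zsol; exists z.
  apply/seteqP; split => [y /cvg_sol xy|y -> //].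
  apply: subr0_eq; apply: enorm0_eq0; apply/eqP; rewrite eq_le enorm_ge0 andbT.
  (* The iterates converge to both solutions, so by the triangle inequality the distance between [y]
     and [z] is bounded by a null sequence. *)
  have lim : enorm (x n.+1 - y) + enorm (x n.+1 - z) @[n --> \oo] --> (0 : R).
    by rewrite -(addr0 0); apply: cvgD => //; exact: cvg_sol.
  rewrite -(cvg_lim _ lim)//; apply: limr_ge; first by apply/cvg_ex; exists 0.
  by apply: nearW => n; rewrite (enormB (x n.+1)) enorm_triangle.
by rewrite /converges_to -cvg_shiftS; exact: cvg_sol.
Qed.
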